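(* Let $I$ be an infinite set and let $\{A_i\}_{i\in I}$ be a family of unital Hilbert algebras, with identities $e_i$, such that $\|e_i\|=1$ for all $i\in I$. Then $A:=\bigotimes^{\rm ut}_{i\in I}A_i$ is also a unital Hilbert algebra with $\|\otimes_{i\in I}e_i\|=1$.
   Context: A (unital) Hilbert algebra is a (unital) $^*$-algebra $A$ over $\mathbb C$ with an inner product such that $\langle xy,z\rangle=\langle y,x^*z\rangle$, $\langle x,y\rangle=\langle y^*,x^*\rangle$, $y\mapsto xy$ is bounded for every $x\in A$, and the span of $\{xy:x,y\in A\}$ is dense in $A$ (automatic in the unital case). $\bigotimes_{i\in I}A_i$ is the vector space with a multilinear (linear in each variable separately) map $x\mapsto\otimes_{i\in I}x_i$ from $\prod_{i\in I}A_i$ through which every multilinear map on $\prod_{i\in I}A_i$ factors via a unique linear map; it is a $^*$-algebra with $(\otimes a_i)(\otimes b_i)=\otimes a_ib_i$ and $(\otimes a_i)^*=\otimes a_i^*$. $U_{A_i}=\{a\in A_i:a^*a=aa^*=e_i\}$; for $x,y\in\prod_{i\in I}(A_i\setminus\{0\})$, $x\sim y$ means $x_i=y_i$ for all but finitely many $i$; $\Omega^{\rm ut}_{I;A}=\prod_{i\in I}U_{A_i}/\sim$; for $\omega=[u]_\sim$, $\bigotimes^\omega_{i\in I}A_i=\mathrm{span}\{\otimes_{i\in I}x_i:x_i=u_i\text{ for all but finitely many }i\}$; and $\bigotimes^{\rm ut}_{i\in I}A_i=\bigoplus_{\omega\in\Omega^{\rm ut}_{I;A}}\bigotimes^\omega_{i\in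 I}A_i$, a unital $^*$-subalgebra of $\bigotimes_{i\in I}A_i$. The inner product on $A$ is the restriction of the inner product $\langle\cdot,\cdot\rangle_{\phi_1}$ on $\bigotimes^{\rm un}_{i\in I}A_i:=\mathrm{span}\{\otimes_{i\in I}x_i:\|x_i\|=1\text{ for all }i\}$, which contains $A$; it is given, for $x,y\in\prod_{i\in I}A_i$ with $\|x_i\|=\|y_i\|=1$ for all $i$, by $\langle\otimes x_i,\otimes y_i\rangle_{\phi_1}=\prod_{i\in I}\langle x_i,y_i\rangle$ if $\langle x_i,y_i\rangle=1$ for all but finitely many $i$, and $0$ otherwise. *)

(* Defs.v *)
From HB Require Import structures.
From mathcomp Require Import all_boot all_order all_algebra.
From mathcomp Require Import boolp classical_sets functions cardinality fsbigop.
From mathcomp Require Import reals complex freeg.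

Set Implicit Arguments.
Unset Strict Implicit.
Unset Printing Implicit Defensive.

Import Order.TTheory GRing.Theory Num.Theory.
Local Open Scope classical_set_scope.
Local Open Scope ring_scope.
Local Open Scope quotient_scope.

Section LinearSpan.
Context (K : nzRingType) (V : lmodType K).
Implicit Types S : set V.

Definition lspan S : {pred V} := fun v =>
  `[< exists s : seq (K * V),
      (forall p, p \in s -> S p.2) /\ v = \sum_(p <- s) p.1 *: p.2 >].

Lemma lspanP S v : reflect (exists s : seq (K * V),
  (forall p, p \in s -> S p.2) /\ v = \sum_(p <- s) p.1 *: p.2) (v \in lspan S).
Proof. by rewrite unfold_in; apply: asboolP. Qed.

Lemma lspan_gen S v : S v -> v \in lspan S.
Proof.
move=> Sv; apply/lspanP; exists [:: (1, v)]; split; last by rewrite big_seq1 scale1r.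
by move=> p; rewrite inE => /eqP ->.
Qed.

Lemma lspan_closed S : subsemimod_closed (lspan S).
Proof.
split; first split.
- by apply/lspanP; exists [::]; split=> //; rewrite big_nil.
- move=> u v /lspanP [s [hs ->]] /lspanP [t [ht ->]].
  apply/lspanP; exists (s ++ t); split; last by rewrite big_cat.
  by move=> p; rewrite mem_cat => /orP [/hs | /ht].
- move=> a v /lspanP [s [hs ->]].
  apply/lspanP; exists [seq (a * p.1, p.2) | p <- s]; split.
    by move=> p /mapP [q /hs hq ->].
  by rewrite big_map scaler_sumr; apply: eq_bigr => p _; rewrite scalerA.
Qed.

HB.instance Definition _ S := GRing.isSubmodClosed.Build K V (lspan S) (lspan_closed S).

Lemma lspan_ind S (P : V -> Prop) : P 0 ->
  (forall v, S v -> P v) ->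
  (forall a u v, P u -> P v -> P (a *: u + v)) ->
  forall v, v \in lspan S -> P v.
Proof.
move=> P0 PS PD v /lspanP [s [hs ->]]; elim: s hs => [|p s IHs] hs.
  by rewrite big_nil.
rewrite big_cons; apply: PD; first by apply: PS; apply: hs; rewrite mem_head.
by apply: IHs => q qs; apply: hs; rewrite inE qs orbT.
Qed.

End LinearSpan.


Section QuotientModule.
Context (K : nzRingType) (V : lmodType K) (S : set V).

(* ring_quotient only provides the additive group structure of V / lspan S. *)
Definition quotmod : Type := Quotient.quot (lspan S).
HB.instance Definition _ := GRing.Zmodule.on quotmod.

Definition quotpi (v : V) : quotmod := \pi_(Quotient.quot (lspan S)) v.

Lemma quotpi_eq u v : quotpi u = quotpi v <-> u - v \in lspan S.
Proof. by rewrite Quotient.idealrBE; split=> [/eqP|/eqP]. Qed.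

Lemma quotpiD u v : quotpi (u + v) = quotpi u + quotpi v.
Proof. by rewrite /quotpi Quotient.pi_add. Qed.

Definition quotscale (a : K) (q : quotmod) : quotmod :=
  quotpi (a *: repr (q : Quotient.quot (lspan S))).

Lemma quotpiK (q : quotmod) : quotpi (repr (q : Quotient.quot (lspan S))) = q.
Proof. exact: reprK. Qed.

Lemma quotpiZ a v : quotpi (a *: v) = quotscale a (quotpi v).
Proof.
apply/quotpi_eq; rewrite -scalerBr rpredZ //.
by apply/quotpi_eq; rewrite quotpiK.
Qed.

Lemma quotmod_ind (P : quotmod -> Prop) : (forall v, P (quotpi v)) -> forall q, P q.
Proof. by move=> h q; rewrite -(quotpiK q). Qed.

Lemma quotscaleA a b q : quotscale a (quotscale b q) = quotscale (a * b) q.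
Proof. by elim/quotmod_ind: q => v; rewrite -!quotpiZ scalerA. Qed.
Lemma quotscale1 : left_id 1 quotscale.
Proof. by elim/quotmod_ind => v; rewrite -!quotpiZ scale1r. Qed.
Lemma quotscaleDr : right_distributive quotscale +%R.
Proof.
move=> a p q; elim/quotmod_ind: p => u; elim/quotmod_ind: q => v.
by rewrite -quotpiD -!quotpiZ -quotpiD scalerDr.
Qed.
Lemma quotscaleDl q : {morph quotscale^~ q : a b / a + b}.
Proof.
by move=> a b; elim/quotmod_ind: q => v; rewrite -!quotpiZ -quotpiD scalerDl.
Qed.
HB.instance Definition _ := GRing.Zmodule_isLmodule.Build K quotmod
  quotscaleA quotscale1 quotscaleDr quotscaleDl.

Lemma quotpi_linear : linear quotpi.
Proof. by move=> a u v; rewrite quotpiD quotpiZ. Qed.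

End QuotientModule.

Lemma fglift_linear (K : nzRingType) (X : choiceType) (W : lmodType K) (f : X -> W) :
  linear (fglift f : {freeg X / K} -> W).
Proof.
have hD := lift_is_additive f.
have h0 : fglift f (0 : {freeg X / K}) = 0 by rewrite -(subr0 0) hD subrr.
have hDD (u v : {freeg X / K}) : fglift f (u + v) = fglift f u + fglift f v.
  by rewrite -[in LHS](opprK v) hD -[in RHS](opprK v) -(sub0r (- v)) [in RHS]hD h0 sub0r.
move=> a u v; rewrite hDD; congr (_ + _).
rewrite /(_ *: _) /= /fgscale.
rewrite -[in RHS](freeg_sumE u) !(big_morph _ hDD h0) scaler_sumr.
by apply: eq_bigr => x _; rewrite !liftU scalerA.
Qed.


(* algType entails 1 != 0, so the zero algebra is not a starAlgType; it is
   excluded anyway in any algebra whose unit has norm 1. *)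
HB.mixin Record Algebra_isStar (C : numClosedFieldType) V of GRing.Algebra C V := {
  star : V -> V;
  starK : involutive star;
  starD : {morph star : x y / x + y};
  starZ : forall (a : C) x, star (a *: x) = a^* *: star x;
  starM : forall x y, star (x * y) = star y * star x
}.

#[short(type="starAlgType")]
HB.structure Definition StarAlgebra (C : numClosedFieldType) :=
  {V of Algebra_isStar C V & GRing.Algebra C V}.


(* Linear in the first variable. *)
Definition inner_product (C : numClosedFieldType) (V : lmodType C)
    (ip : V -> V -> C) : Prop :=
  [/\ forall z, scalar (fun x => ip x z),
      forall x y, ip y x = (ip x y)^*,
      forall x, 0 <= ip x x &
      forall x, ip x x = 0 -> x = 0].

Definition hnorm (C : numClosedFieldType) (V : lmodType C)
    (ip : V -> V -> C) (x : V) : C := sqrtC (ip x x).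

Definition hilbert_algebra (C : numClosedFieldType) (V : starAlgType C)
    (ip : V -> V -> C) : Prop :=
  [/\ inner_product ip,
      forall x y z, ip (x * y) z = ip y (star x * z),
      forall x y, ip x y = ip (star y) (star x),
      forall x, exists M : C, forall y, hnorm ip (x * y) <= M * hnorm ip y &
      forall (z : V) (e : C), 0 < e ->
        exists2 w, w \in lspan [set v | exists x y, v = x * y] &
                   hnorm ip (z - w) < e].

HB.mixin Record StarAlgebra_isUnitalHilbert (C : numClosedFieldType) V
    of StarAlgebra C V := {
  dotp : V -> V -> C;
  dotp_hilbert : hilbert_algebra dotp
}.

#[short(type="unitalHilbertAlgType")]
HB.structure Definition UnitalHilbertAlgebra (C : numClosedFieldType) :=
  {V of StarAlgebra_isUnitalHilbert C V & StarAlgebra C V}.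

Section InfiniteTensor.
Context (C : numClosedFieldType) (I : choiceType) (A : I -> unitalHilbertAlgType C).
Local Notation X := (forall i, A i).

(* dfwith x a is x with its i-th coordinate replaced by a : A i. *)
Definition multilinear (W : lmodType C) (f : X -> W) : Prop :=
  forall (i : I) (x : X), linear (fun a : A i => f (dfwith x a)).

Definition multilinear_relators : set {freeg X / C} :=
  [set r | exists (i : I) (x : X) (c : C) (a b : A i),
     r = << dfwith x (c *: a + b) >> - (c *: << dfwith x a >> + << dfwith x b >>)].

(* The tensor product of (A i)_i is the free module on the product of the A i
   modulo the relations of multilinearity; its defining universal property is
   tensor_universal below. *)
Definition tensor : Type := quotmod multilinear_relators.
HB.instance Definition _ := GRing.Lmodule.on tensor.

Definition tmap (x : X) : tensor := quotpi multilinear_relators << x >>.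

(* Only meaningful for multilinear f: see tlift_tmap and tlift_linear. *)
Definition tlift (W : lmodType C) (f : X -> W) (t : tensor) : W :=
  fglift f (repr (t : Quotient.quot (lspan multilinear_relators))).

End InfiniteTensor.

Section InfiniteTensorTheory.
Context (C : numClosedFieldType) (I : choiceType) (A : I -> unitalHilbertAlgType C).
Local Notation X := (forall i, A i).
Local Notation T := (tensor A).

Lemma tmap_multilinear : multilinear (@tmap C I A).
Proof.
move=> i x c a b; apply: etrans; last exact: quotpi_linear.
by apply/quotpi_eq; apply: lspan_gen; exists i, x, c, a, b.
Qed.

Lemma fglift_relators (W : lmodType C) (f : X -> W) : multilinear f ->
  forall r, r \in lspan (@multilinear_relators C I A) -> fglift f r = 0.
Proof.
move=> hf; pose g : {linear {freeg X / C} -> W} :=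
  HB.pack (fglift f) (GRing.isLinear.Build _ _ _ _ (fglift f) (fglift_linear f)).
apply: lspan_ind => [|r [i [x [c [a [b ->]]]]]|a u v hu hv].
- exact: (linear0 g).
- rewrite -[fglift f]/(g : _ -> _) linearB linearD linearZ /= !liftU !scale1r.
  by rewrite hf subrr.
- by rewrite fglift_linear hu hv scaler0 addr0.
Qed.

Lemma tlift_pi (W : lmodType C) (f : X -> W) : multilinear f ->
  forall v, tlift f (quotpi _ v) = fglift f v.
Proof.
move=> hf v; rewrite /tlift; set w := repr _.
have /quotpi_eq/(fglift_relators hf) : quotpi (@multilinear_relators C I A) w = quotpi _ v.
  by rewrite /w quotpiK.
rewrite addrC -scaleN1r fglift_linear scaleN1r => /eqP.
by rewrite addrC subr_eq0 => /eqP.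
Qed.

Lemma tlift_tmap (W : lmodType C) (f : X -> W) : multilinear f ->
  forall x, tlift f (tmap x) = f x.
Proof. by move=> hf x; rewrite /tmap tlift_pi // liftU scale1r. Qed.

Lemma tlift_linear (W : lmodType C) (f : X -> W) : multilinear f ->
  linear (tlift f).
Proof.
move=> hf a; elim/quotmod_ind => u; elim/quotmod_ind => v.
by rewrite -[_ *: _ + _]quotpi_linear !tlift_pi // fglift_linear.
Qed.

Lemma tensor_ind (P : T -> Prop) : P 0 -> (forall x, P (tmap x)) ->
  (forall (a : C) u v, P u -> P v -> P (a *: u + v)) -> forall t, P t.
Proof.
move=> P0 Pt PD; elim/quotmod_ind => v; rewrite -(freeg_sumE v).
elim: (dom v) => [|x s IHs].
  by rewrite big_nil; have := quotpi_linear (@multilinear_relators C I A) (-1) 0 0;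
     rewrite scaleN1r addNr scaleN1r => ->; rewrite addNr.
rewrite big_cons.
have -> : << coeff x v *g x >> = coeff x v *: << x >> :> {freeg X / C}.
  by apply/eqP/freeg_eqP => y; rewrite coeffZ !coeffU mulrA mulr1.
by rewrite [quotpi _ _]quotpi_linear; apply: PD => //; exact: Pt.
Qed.

Theorem tensor_universal (W : lmodType C) (f : X -> W) : multilinear f ->
  exists! g : {linear T -> W}, forall x, g (tmap x) = f x.
Proof.
move=> hf; pose g : {linear T -> W} :=
  HB.pack (tlift f) (GRing.isLinear.Build _ _ _ _ (tlift f) (tlift_linear hf)).
exists g; split=> [x|h hh]; first exact: tlift_tmap.
suff e : g =1 h.
  case: g h e {hh} => [g [[cg1] [cg2]]] [h [[ch1] [ch2]]] /= /funext e.
  by subst h; congr (GRing.Linear.Pack (GRing.Linear.Class _ _)); congr (_ _);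
    apply: Prop_irrelevance.
elim/tensor_ind => [|x|a u v hu hv]; first by rewrite !linear0.
  by rewrite hh; exact: tlift_tmap.
by rewrite !linearP hu hv.
Qed.

End InfiniteTensorTheory.

Section TensorAlgebra.
Context (C : numClosedFieldType) (I : choiceType) (A : I -> unitalHilbertAlgType C).
Local Notation X := (forall i, A i).
Local Notation T := (tensor A).
Implicit Types x y z : X.

Lemma dfwith_map (B : I -> Type) (f : forall i, A i -> B i) x (i : I) (a : A i) :
  (fun j => f j (dfwith x a j)) = dfwith (fun j => f j (x j)) (f i a).
Proof.
apply: functional_extensionality_dep => j.
by case: dfwithP => [|j' ij]; rewrite ?dfwith_in ?dfwith_out.
Qed.

Lemma multilinear_tmap (f : forall i, A i -> A i) : (forall i, linear (f i)) ->
  multilinear (fun x => tmap (fun i => f i (x i))).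
Proof.
by move=> hf i x c a b; rewrite !dfwith_map hf; exact: tmap_multilinear.
Qed.

Definition tone : T := tmap (fun=> 1).

(* The unique bilinear map with tmul_tmap. *)
Definition tmul (s t : T) : T :=
  tlift (fun x => tlift (fun y => tmap (fun i => x i * y i)) t) s.

Lemma tmul_mlr x : multilinear (fun y => tmap (fun i => x i * y i)).
Proof.
apply: (multilinear_tmap (f := fun i a => x i * a)) => i c a b /=.
by rewrite mulrDr -scalerAr.
Qed.

Lemma tmul_mll t : multilinear (fun x => tlift (fun y => tmap (fun i => x i * y i)) t).
Proof.
move=> i x c a b; elim/tensor_ind: t => [|y|d u v hu hv].
- have h0 (W : lmodType C) (f : X -> W) : multilinear f -> tlift f 0 = 0.
    move=> hf; have := tlift_linear hf (-1) 0 0.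
    by rewrite !scaleN1r !addNr.
  by rewrite !h0 ?scaler0 ?addr0 //; exact: tmul_mlr.
- rewrite !tlift_tmap; try exact: tmul_mlr.
  rewrite !(dfwith_map (fun i (a : A i) => a * y i)) mulrDl -scalerAl.
  exact: tmap_multilinear.
- rewrite !(tlift_linear (tmul_mlr _)) hu hv !scalerDr !scalerA mulrC.
  by rewrite addrACA.
Qed.

Lemma tmul_linearl t : linear (tmul^~ t).
Proof. exact: (tlift_linear (tmul_mll t)). Qed.

Lemma tmul_linearr s : linear (tmul s).
Proof.
move=> c u v; elim/tensor_ind: s => [|x|d s t hs ht].
- have h0 w : tmul 0 w = 0.
    by have := tmul_linearl w (-1) 0 0; rewrite !scaleN1r !addNr.
  by rewrite !h0 scaler0 addr0.
- by rewrite /tmul !(tlift_tmap (tmul_mll _)); exact: (tlift_linear (tmul_mlr x)).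
- by rewrite !tmul_linearl hs ht !scalerDr !scalerA mulrC addrACA.
Qed.

Lemma tmul_tmap x y : tmul (tmap x) (tmap y) = tmap (fun i => x i * y i).
Proof. by rewrite /tmul (tlift_tmap (tmul_mll _)) (tlift_tmap (tmul_mlr _)). Qed.

Lemma tmul0l t : tmul 0 t = 0.
Proof. by have := tmul_linearl t (-1) 0 0; rewrite !scaleN1r !addNr. Qed.
Lemma tmul0r t : tmul t 0 = 0.
Proof. by have := tmul_linearr t (-1) 0 0; rewrite !scaleN1r !addNr. Qed.
Lemma tmulDl : left_distributive tmul +%R.
Proof. by move=> u v t; have := tmul_linearl t 1 u v; rewrite !scale1r. Qed.
Lemma tmulDr : right_distributive tmul +%R.
Proof. by move=> t u v; have := tmul_linearr t 1 u v; rewrite !scale1r. Qed.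
Lemma tscaleAl (a : C) u v : a *: tmul u v = tmul (a *: u) v.
Proof. by have := tmul_linearl v a u 0; rewrite tmul0l !addr0. Qed.
Lemma tscaleAr (a : C) u v : a *: tmul u v = tmul u (a *: v).
Proof. by have := tmul_linearr u a v 0; rewrite tmul0r !addr0. Qed.

Lemma tmulA : associative tmul.
Proof.
move=> r s t; elim/tensor_ind: r => [|x|a u v hu hv].
- by rewrite !tmul0l.
- elim/tensor_ind: s => [|y|a u v hu hv].
  + by rewrite tmul0l tmul0r tmul0l.
  + elim/tensor_ind: t => [|z|a u v hu hv].
    * by rewrite !tmul0r.
    * rewrite !tmul_tmap; congr tmap.
      by apply: functional_extensionality_dep => i; rewrite mulrA.
    * by rewrite !tmul_linearr hu hv.
  + by rewrite tmul_linearl !tmul_linearr tmul_linearl hu hv.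
- by rewrite !tmul_linearl hu hv.
Qed.

Lemma tmul1l : left_id tone tmul.
Proof.
elim/tensor_ind => [|x|a u v hu hv]; first by rewrite tmul0r.
  rewrite tmul_tmap; congr tmap.
  by apply: functional_extensionality_dep => i; rewrite mul1r.
by rewrite tmul_linearr hu hv.
Qed.

Lemma tmul1r : right_id tone tmul.
Proof.
elim/tensor_ind => [|x|a u v hu hv]; first by rewrite tmul0l.
  rewrite tmul_tmap; congr tmap.
  by apply: functional_extensionality_dep => i; rewrite mulr1.
by rewrite tmul_linearl hu hv.
Qed.

(* The big product over [set: I] ranges over the indices whose factor is not 1. *)
Definition finprod (f : forall i, A i -> C) x : C :=
  if `[< finite_set [set i | f i (x i) != 1] >]
  then \big[*%R/1]_(i \in [set: I]) f i (x i) else 0.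

Lemma finprod_dfwith (f : forall i, A i -> C) x i :
  exists D : C, forall a : A i, finprod f (dfwith x a) = f i a * D.
Proof.
have fin (a : A i) : `[< finite_set [set j | f j (dfwith x a j) != 1] >] =
    `[< finite_set [set j | j <> i /\ f j (x j) != 1] >].
  apply/asbool_equiv_eq; split => h.
    apply: sub_finite_set h => j /= [/eqP ji fj].
    by rewrite dfwith_out // eq_sym.
  apply: (@sub_finite_set _ _ ([set i] `|` [set j | j <> i /\ f j (x j) != 1])).
    move=> j /=; case: (dfwithP x a j) => [|j' ij]; first by left.
    by move=> fj; right; split=> // ji; rewrite ji eqxx in ij.
  by rewrite finite_setU; split=> //; exact: finite_set1.
case: (asboolP (finite_set [set j | j <> i /\ f j (x j) != 1])) => hfin; last first.
  by exists 0 => a; rewrite /finprod fin asboolF // mulr0.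
set S := [set j | j <> i /\ f j (x j) != 1] in hfin fin *.
exists (\big[*%R/1]_(j \in S) f j (x j)) => a.
rewrite /finprod fin asboolT //.
rewrite -(fsbig_widen ([set i] `|` S)) //; last first.
  move=> j [_ /= /not_orP [ji nS]]; have [ij|ij] := eqVneq i j; first by case: ji.
  rewrite dfwith_out //; apply/eqP/negPn/negP => fj; apply: nS; split=> //.
rewrite fsbigU //=; last by move=> j [-> []].
rewrite fsbig_set1 dfwith_in; congr (_ * _).
apply: eq_fsbigr => j; rewrite inE /S /= => -[ji _].
by rewrite dfwith_out //; apply/eqP => ij; apply: ji.
Qed.

Lemma finprod_multilinear (f : forall i, A i -> C) : (forall i, scalar (f i)) ->
  multilinear (W := C^o) (finprod f).
Proof.
move=> hf i x c a b; have [D hD] := finprod_dfwith f x i.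
by rewrite !hD hf mulrDl -mulrA.
Qed.

Lemma finprod1 (f : forall i, A i -> C) x : (forall i, f i (x i) = 1) ->
  finprod f x = 1.
Proof.
move=> h; rewrite /finprod asboolT.
  by apply: fsbig1 => i _; rewrite h.
by apply: sub_finite_set (@finite_set0 I) => i /=; rewrite h eqxx.
Qed.

Lemma dotp_scalar i (b : A i) : scalar (fun a => dotp a b).
Proof. by have [[h _ _ _] _ _ _ _] := @dotp_hilbert C (A i); exact: h. Qed.

Lemma dotp_conj i (a b : A i) : dotp b a = (dotp a b)^*.
Proof. by have [[_ h _ _] _ _ _ _] := @dotp_hilbert C (A i); exact: h. Qed.

Lemma dotp_eq0 i (a : A i) : dotp a a = 0 -> a = 0.
Proof. by have [[_ _ _ h] _ _ _ _] := @dotp_hilbert C (A i); exact: h. Qed.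

Lemma tone_neq0 : tone != 0.
Proof.
pose f i (a : A i) := dotp a 1 / dotp (1 : A i) 1.
have hf i : scalar (f i).
  by move=> c a b; rewrite /f dotp_scalar mulrDl mulrA.
have ml := finprod_multilinear hf.
apply/eqP => /(congr1 (tlift (W := C^o) (finprod f))).
rewrite tlift_tmap // finprod1 => [|i]; last first.
  rewrite /f divff //; apply/eqP => /dotp_eq0 /eqP; exact/negP/oner_neq0.
have := tlift_linear ml (-1) 0 0; rewrite !scaleN1r !addNr => -> /eqP.
exact/negP/oner_neq0.
Qed.

HB.instance Definition _ := GRing.Zmodule_isNzRing.Build T
  tmulA tmul1l tmul1r tmulDl tmulDr tone_neq0.
HB.instance Definition _ := GRing.Lmodule_isLalgebra.Build C T tscaleAl.
HB.instance Definition _ := GRing.Lalgebra_isAlgebra.Build C T tscaleAr.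

End TensorAlgebra.

Section ConjugateModule.
Context (C : numClosedFieldType) (V : lmodType C).

(* V with the conjugate scalar action, so that conjugate-linear maps to V are
   linear maps to conjmod. *)
Definition conjmod : Type := V.
HB.instance Definition _ := GRing.Zmodule.on conjmod.

Definition conjscale (a : C) (v : conjmod) : conjmod := a^* *: (v : V).

Lemma conjscaleA a b v : conjscale a (conjscale b v) = conjscale (a * b) v.
Proof. by rewrite /conjscale scalerA rmorphM. Qed.
Lemma conjscale1 : left_id 1 conjscale.
Proof. by move=> v; rewrite /conjscale rmorph1 scale1r. Qed.
Lemma conjscaleDr : right_distributive conjscale +%R.
Proof. by move=> a u v; exact: scalerDr. Qed.
Lemma conjscaleDl v : {morph conjscale^~ v : a b / a + b}.
Proof. by move=> a b; rewrite /conjscale rmorphD; exact: scalerDl. Qed.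
HB.instance Definition _ := GRing.Zmodule_isLmodule.Build C conjmod
  conjscaleA conjscale1 conjscaleDr conjscaleDl.

End ConjugateModule.

Section TensorStar.
Context (C : numClosedFieldType) (I : choiceType) (A : I -> unitalHilbertAlgType C).
Local Notation X := (forall i, A i).
Local Notation T := (tensor A).
Implicit Types x y z : X.

Definition tstar (t : T) : T :=
  tlift (W := conjmod T) (fun x => tmap (fun i => star (x i))) t.

Lemma tstar_ml : multilinear (W := conjmod T) (fun x => tmap (fun i => star (x i))).
Proof.
move=> i x c a b; rewrite !(dfwith_map (fun i (a : A i) => star a)) starD starZ.
exact: tmap_multilinear.
Qed.

Lemma tstar_tmap x : tstar (tmap x) = tmap (fun i => star (x i)).
Proof. exact: (tlift_tmap tstar_ml). Qed.

Lemma tstarP (a : C) u v : tstar (a *: u + v) = a^* *: tstar u + tstar v.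
Proof. exact: (tlift_linear tstar_ml). Qed.

Lemma tstarD : {morph tstar : x y / x + y}.
Proof. by move=> u v; have := tstarP 1 u v; rewrite rmorph1 !scale1r. Qed.

Lemma tstar0 : tstar 0 = 0.
Proof. by apply: (addrI (tstar 0)); rewrite -tstarD !addr0. Qed.

Lemma tstarZ (a : C) u : tstar (a *: u) = a^* *: tstar u.
Proof. by have := tstarP a u 0; rewrite tstar0 !addr0. Qed.

Lemma tstarK : involutive tstar.
Proof.
elim/tensor_ind => [|x|a u v hu hv]; first by rewrite !tstar0.
  rewrite !tstar_tmap; congr tmap.
  by apply: functional_extensionality_dep => i; rewrite starK.
by rewrite !tstarP hu hv conjCK.
Qed.

Lemma tmulE x y : tmap x * tmap y = tmap (fun i => x i * y i).
Proof. exact: tmul_tmap. Qed.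

Lemma tstarM (s t : T) : tstar (s * t) = tstar t * tstar s.
Proof.
elim/tensor_ind: s => [|x|a u v hu hv].
- by rewrite mul0r !tstar0 mulr0.
- elim/tensor_ind: t => [|y|a u v hu hv].
  + by rewrite mulr0 !tstar0 mul0r.
  + rewrite tmulE !tstar_tmap tmulE; congr tmap.
    by apply: functional_extensionality_dep => i; rewrite starM.
  + by rewrite mulrDr -scalerAr !tstarP hu hv mulrDl -scalerAl.
- by rewrite mulrDl -scalerAl !tstarP hu hv mulrDr -scalerAr.
Qed.

HB.instance Definition _ := Algebra_isStar.Build C T tstarK tstarD tstarZ tstarM.

Lemma starE x : star (tmap x) = tmap (fun i => star (x i)).
Proof. exact: tstar_tmap. Qed.

End TensorStar.

Section UnitaryTensor.
Context (C : numClosedFieldType) (I : choiceType) (A : I -> unitalHilbertAlgType C).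
Local Notation X := (forall i, A i).
Local Notation T := (tensor A).
Implicit Types x y z u v : X.

Definition sim x y : Prop := finite_set [set i | x i <> y i].

Definition unitary (V : starAlgType C) (a : V) : Prop :=
  star a * a = 1 /\ a * star a = 1.

(* The points of the quotient of the unitary families by sim, as sets. *)
Definition Omega_ut : set (set X) :=
  [set w | exists2 u, (forall i, unitary (u i)) &
    w = [set v | (forall i, unitary (v i)) /\ sim v u]].

Definition tensor_class (w : set X) : {pred T} :=
  lspan [set t | exists x u, [/\ w u, sim x u & t = tmap x]].

(* The sum of the tensor_class w; it is direct by tensor_class_direct. *)
Definition ut : {pred T} :=
  lspan (\bigcup_(w in Omega_ut) [set t | t \in tensor_class w]).

Definition ut_gen : set T :=
  [set t | exists x u, [/\ (forall i, unitary (u i)), sim x u & t = tmap x]].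

Lemma sim_refl x : sim x x.
Proof. by apply: sub_finite_set (@finite_set0 I) => i. Qed.

Lemma sim_sym x y : sim x y -> sim y x.
Proof. by apply: sub_finite_set => i /= h /esym. Qed.

Lemma sim_trans x y z : sim x y -> sim y z -> sim x z.
Proof.
move=> xy yz; apply: (@sub_finite_set _ _ ([set i | x i <> y i] `|` [set i | y i <> z i])).
  by move=> i /= xz; case: (pselect (x i = y i)) => [e|]; [right; rewrite -e|left].
by rewrite finite_setU.
Qed.

Lemma sim_map2 (f : forall i, A i -> A i -> A i) x u y v :
  sim x u -> sim y v -> sim (fun i => f i (x i) (y i)) (fun i => f i (u i) (v i)).
Proof.
move=> xu yv; apply: (@sub_finite_set _ _ ([set i | x i <> u i] `|` [set i | y i <> v i])).
  move=> i /= h; case: (pselect (x i = u i)) => [e|]; [right|by left].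
  by move=> e'; apply: h; rewrite e e'.
by rewrite finite_setU.
Qed.

Lemma unitary1 (V : starAlgType C) : unitary (1 : V).
Proof.
have s1 : star (1 : V) = 1.
  have -> : star (1 : V) = star 1 * star (star 1) by rewrite starK mulr1.
  by rewrite -starM mulr1 starK.
by split; rewrite s1 mul1r.
Qed.

Lemma unitaryM (V : starAlgType C) (a b : V) : unitary a -> unitary b -> unitary (a * b).
Proof.
move=> [a1 a2] [b1 b2]; split; rewrite starM.
  by rewrite mulrA -(mulrA _ (star a)) a1 mulr1.
by rewrite mulrA -(mulrA a) b2 mulr1.
Qed.

Lemma unitary_star (V : starAlgType C) (a : V) : unitary a -> unitary (star a).
Proof. by move=> [a1 a2]; split; rewrite starK. Qed.

Lemma utE : ut =i lspan ut_gen.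
Proof.
move=> t; apply/idP/idP; move: t; apply: lspan_ind.
- exact: rpred0.
- move=> t [w [u hu ->]] /=; move: t; apply: lspan_ind.
  + exact: rpred0.
  + move=> t [x [v [[hv vu] xv ->]]]; apply: lspan_gen.
    by exists x, v; split.
  + by move=> a s t hs ht; rewrite rpredD // rpredZ.
- by move=> a s t hs ht; rewrite rpredD // rpredZ.
- exact: rpred0.
- move=> t [x [u [hu xu ->]]]; apply: lspan_gen.
  exists [set v | (forall i, unitary (v i)) /\ sim v u]; first by exists u.
  apply: lspan_gen; exists x, u; split=> //; split=> //; exact: sim_refl.
- by move=> a s t hs ht; rewrite rpredD // rpredZ.
Qed.

Lemma ut_tmap x u : (forall i, unitary (u i)) -> sim x u -> tmap x \in ut.
Proof. by move=> hu xu; rewrite utE; apply: lspan_gen; exists x, u. Qed.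

Lemma ut_mul (s t : T) : s \in ut -> t \in ut -> s * t \in ut.
Proof.
rewrite !utE => hs ht; move: s hs; apply: lspan_ind.
- by rewrite mul0r rpred0.
- move=> s [x [u [hu xu ->]]]; move: t ht; apply: lspan_ind.
  + by rewrite mulr0 rpred0.
  + move=> t [y [v [hv yv ->]]]; rewrite tmulE; apply: lspan_gen.
    exists (fun i => x i * y i), (fun i => u i * v i); split=> //.
      by move=> i; apply: unitaryM.
    exact: (sim_map2 (fun i a b => a * b)).
  + by move=> a p q hp hq; rewrite mulrDr -scalerAr rpredD // rpredZ.
- by move=> a p q hp hq; rewrite mulrDl -scalerAl rpredD // rpredZ.
Qed.

Lemma ut_star_closed (t : T) : t \in ut -> star t \in ut.
Proof.
rewrite !utE; move: t; apply: lspan_ind.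
- by rewrite [star _]tstar0 rpred0.
- move=> t [x [u [hu xu ->]]]; rewrite starE; apply: lspan_gen.
  exists (fun i => star (x i)), (fun i => star (u i)); split=> //.
    by move=> i; apply: unitary_star.
  exact: (sim_map2 (fun i a _ => star a) xu xu).
- by move=> a p q hp hq; rewrite starD starZ rpredD // rpredZ.
Qed.

Lemma ut_closed : GRing.subsemialg_closed ut.
Proof.
split.
- by apply: (@ut_tmap _ (fun=> 1)) (sim_refl _) => i; exact: unitary1.
- by split; [exact: rpred0 | move=> s t hs ht; apply: rpredD].
- by move=> a t ht; apply: rpredZ.
- by move=> s t; apply: ut_mul.
Qed.

Record ut_tensor : Type := UtTensor { ut_val :> T; ut_valP : ut_val \in ut }.
HB.instance Definition _ := [isSub for ut_val].
HB.instance Definition _ := [Choice of ut_tensor by <:].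
HB.instance Definition _ :=
  GRing.SubChoice_isSubAlgebra.Build C T ut ut_tensor ut_closed.

Definition ut_star (t : ut_tensor) : ut_tensor := UtTensor (ut_star_closed (ut_valP t)).

Lemma ut_starK : involutive ut_star.
Proof. by move=> t; apply: val_inj; rewrite /= starK. Qed.
Lemma ut_starD : {morph ut_star : s t / s + t}.
Proof. by move=> s t; apply: val_inj; rewrite /= starD. Qed.
Lemma ut_starZ (a : C) t : ut_star (a *: t) = a^* *: ut_star t.
Proof. by apply: val_inj; rewrite /= starZ. Qed.
Lemma ut_starM s t : ut_star (s * t) = ut_star t * ut_star s.
Proof. by apply: val_inj; rewrite /= starM. Qed.
HB.instance Definition _ :=
  Algebra_isStar.Build C ut_tensor ut_starK ut_starD ut_starZ ut_starM.

Definition ut_pure u (hu : forall i, unitary (u i)) : ut_tensor :=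
  UtTensor (ut_tmap hu (sim_refl u)).

Lemma ut_oneE : 1 = ut_pure (fun i => unitary1 (A i)).
Proof. exact: val_inj. Qed.

End UnitaryTensor.

Section TensorForm.
Context (C : numClosedFieldType) (I : choiceType) (A : I -> unitalHilbertAlgType C).
Local Notation X := (forall i, A i).
Local Notation T := (tensor A).
Implicit Types x y z u v : X.

(* The value prescribed for the form on pure tensors of unit vectors. It is
   multilinear in x and conjugate multilinear in y without any condition on the
   norms. *)
Definition phi1 x y : C :=
  if `[< finite_set [set i | dotp (x i) (y i) != 1] >]
  then \big[*%R/1]_(i \in [set: I]) dotp (x i) (y i) else 0.

(* The sesquilinear form with tdot (tmap x) (tmap y) = phi1 x y. It is defined
   on the whole of T, but only its restriction to un below matters: there it is
   the only sesquilinear form with the prescribed values on pure tensors of unit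
   vectors (tdot_unique). *)
Definition tdot (s t : T) : C :=
  (tlift (W := C^o) (fun y => (tlift (W := C^o) (fun x => phi1 x y) s)^*) t)^*.

Lemma phi1_conj x y : phi1 y x = (phi1 x y)^*.
Proof.
rewrite /phi1.
have e i : dotp (y i) (x i) = (dotp (x i) (y i))^* by exact: dotp_conj.
have e1 i : (dotp (y i) (x i) != 1) = (dotp (x i) (y i) != 1).
  rewrite e; congr negb; apply/eqP/eqP => h; last by rewrite h rmorph1.
  by rewrite -[LHS]conjCK h rmorph1.
have -> : [set i | dotp (y i) (x i) != 1] = [set i | dotp (x i) (y i) != 1].
  by apply/seteqP; split=> i /=; rewrite e1.
case: asboolP => _; last by rewrite rmorph0.
have -> : finite_support 1 [set: I] (fun i => dotp (y i) (x i)) =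
          finite_support 1 [set: I] (fun i => dotp (x i) (y i)).
  rewrite /finite_support !unlock.
  have es : (fun i => dotp (y i) (x i)) @^-1` [set~ 1] =
            (fun i => dotp (x i) (y i)) @^-1` [set~ 1].
    apply/seteqP; split=> i /= /eqP h; apply/eqP; first by rewrite -e1.
    by rewrite e1.
  by rewrite es.
by rewrite rmorph_prod; apply: eq_bigr => i _; rewrite e.
Qed.

Lemma phi1_mll y : multilinear (W := C^o) (fun x => phi1 x y).
Proof.
exact: (finprod_multilinear (f := fun i a => dotp a (y i)) (fun i => @dotp_scalar _ _ _ i (y i))).
Qed.

Lemma phi1_mlr s :
  multilinear (W := C^o) (fun y => (tlift (W := C^o) (fun x => phi1 x y) s)^*).
Proof.
move=> i y c a b; elim/tensor_ind: s => [|x|d s t hs ht].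
- have h0 z : tlift (W := C^o) (fun x => phi1 x z) 0 = 0.
    by have := tlift_linear (phi1_mll z) (-1) 0 0; rewrite !scaleN1r !addNr.
  by rewrite !h0 !rmorph0 scaler0 addr0.
- rewrite !(tlift_tmap (phi1_mll _)) -!phi1_conj; exact: phi1_mll.
- rewrite !(tlift_linear (phi1_mll _)) !rmorphD /= !rmorphM /= hs ht.
  have sc (p : C) (q : C^o) : p *: q = p * q by [].
  by rewrite !sc !mulrDr !mulrA [d^* * c]mulrC addrACA.
Qed.

Lemma tdot_tmap x y : tdot (tmap x) (tmap y) = phi1 x y.
Proof.
by rewrite /tdot (tlift_tmap (phi1_mlr _)) (tlift_tmap (phi1_mll _)) conjCK.
Qed.

Lemma tdot_conjlinear s (a : C) t1 t2 :
  tdot s (a *: t1 + t2) = a^* * tdot s t1 + tdot s t2.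
Proof. by rewrite /tdot (tlift_linear (phi1_mlr _)) rmorphD /= rmorphM. Qed.

Lemma tdot0r s : tdot s 0 = 0.
Proof.
have := tdot_conjlinear s (-1) 0 0; rewrite scaleN1r addNr rmorphN1 mulN1r addNr.
by [].
Qed.

Lemma tdot_scalar t : scalar (fun s => tdot s t).
Proof.
move=> a s1 s2; elim/tensor_ind: t => [|y|d u v hu hv].
- by rewrite !tdot0r mulr0 addr0.
- rewrite /tdot !(tlift_tmap (phi1_mlr _)) !conjCK.
  exact: (tlift_linear (phi1_mll y)).
- by rewrite !tdot_conjlinear hu hv /= !mulrDr !mulrA [d^* * a]mulrC addrACA.
Qed.

Definition un : {pred T} :=
  lspan [set t | exists2 x, (forall i, hnorm (@dotp C (A i)) (x i) = 1) & t = tmap x].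

Lemma tdot_unique (B : T -> T -> C) :
  (forall a, {in un & &, forall r s t, B (a *: r + s) t = a * B r t + B s t}) ->
  (forall a, {in un & &, forall r s t, B r (a *: s + t) = a^* * B r s + B r t}) ->
  (forall x y, (forall i, hnorm (@dotp C (A i)) (x i) = 1) ->
     (forall i, hnorm (@dotp C (A i)) (y i) = 1) -> B (tmap x) (tmap y) = phi1 x y) ->
  {in un &, forall s t, B s t = tdot s t}.
Proof.
move=> Bl Br Bf s t us ut.
have u0 : 0 \in un by exact: rpred0.
have gen x : (forall i, hnorm (@dotp C (A i)) (x i) = 1) -> tmap x \in un.
  by move=> hx; apply: lspan_gen; exists x.
have tl a p q r : tdot (a *: p + q) r = a * tdot p r + tdot q r by exact: tdot_scalar.
have B0l r : r \in un -> B 0 r = 0.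
  move=> ur; have := Bl (-1) 0 0 r u0 u0 ur.
  by rewrite scaleN1r addNr mulN1r addNr.
have B0r r : r \in un -> B r 0 = 0.
  move=> ur; have := Br (-1) r 0 0 ur u0 u0.
  by rewrite scaleN1r addNr rmorphN1 mulN1r addNr.
have t0l r : tdot 0 r = 0.
  by have := tl (-1) 0 0 r; rewrite scaleN1r addNr mulN1r addNr.
suff [] : s \in un /\ B s t = tdot s t by [].
move: s us; apply: lspan_ind => [|s [x hx ->]|a p q [up hp] [uq hq]].
- by rewrite B0l // t0l.
- split; first exact: gen.
  suff [] : t \in un /\ B (tmap x) t = tdot (tmap x) t by [].
  move: t ut; apply: lspan_ind => [|t [y hy ->]|a p q [up hp] [uq hq]].
  + by rewrite B0r ?tdot0r //; exact: gen.
  + by rewrite tdot_tmap Bf //; split=> //; exact: gen.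
  + split; first by rewrite rpredD // rpredZ.
    by rewrite tdot_conjlinear Br ?hp ?hq //; exact: gen.
- split; first by rewrite rpredD // rpredZ.
  by rewrite tl Bl // hp hq.
Qed.

Lemma hnorm_unitary (i : I) (a : A i) : hnorm (@dotp C (A i)) 1 = 1 ->
  unitary a -> hnorm (@dotp C (A i)) a = 1.
Proof.
move=> h1 [ha _]; rewrite -[RHS]h1 /hnorm; congr sqrtC.
have [_ hm _ _ _] := @dotp_hilbert C (A i).
by rewrite -{1}[a]mulr1 hm ha.
Qed.

Lemma hnormZ (V : lmodType C) (ip : V -> V -> C) (c : C) (x : V) :
  inner_product ip -> hnorm ip (c *: x) = `|c| * hnorm ip x.
Proof.
move=> [hl hc hp _]; rewrite /hnorm.
have hZ d (y z : V) : ip (d *: y) z = d * ip y z.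
  have h0 : ip 0 z = 0.
    by have := hl z (-1) 0 0; rewrite scaleN1r addNr /= mulN1r addNr.
  by have := hl z d y 0; rewrite h0 !addr0.
rewrite hZ hc hZ rmorphM /= -hc mulrA -normCK rootCMl ?exprn_ge0 //.
by rewrite sqrCK.
Qed.

Lemma ut_sub_un : (forall i, hnorm (@dotp C (A i)) 1 = 1) -> {subset ut (A := A) <= un}.
Proof.
move=> he t; rewrite utE; move: t; apply: lspan_ind.
- exact: rpred0.
- move=> t [x [u [hu xu ->]]].
  have hnu i := hnorm_unitary (he i) (hu i).
  suff : forall (s : seq I) x,
      (forall i, i \notin s -> hnorm (@dotp C (A i)) (x i) = 1) -> tmap x \in un.
    case/finite_fsetP : xu => F hF /(_ (finmap.enum_fset F)); apply=> i iF.
    suff -> : x i = u i by [].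
    apply: contrapT => h; move/negP: iF; apply.
    by have : [set i | x i <> u i] i by []; rewrite hF.
  elim=> {x xu} [|i s IHs] x hx.
    by apply: lspan_gen; exists x => // i; apply: hx.
  have ex : x = dfwith x (x i).
    by apply: functional_extensionality_dep => j; case: dfwithP.
  have [[hl hc hp h0] _ _ _ _] := @dotp_hilbert C (A i).
  set n := hnorm (@dotp C (A i)) (x i).
  suff : forall a : A i, hnorm (@dotp C (A i)) a = 1 -> tmap (dfwith x a) \in un.
    move=> hone; rewrite ex.
    have hml (c : C) (a : A i) : tmap (dfwith x (c *: a)) = c *: tmap (dfwith x a).
      have := tmap_multilinear x c a 0; have := tmap_multilinear x (-1) (0 : A i) 0.
      by rewrite !scaleN1r !addNr addr0 => -> ->; rewrite addr0.
    have [xi0|xi0] := eqVneq (x i) 0.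
      by rewrite xi0 -(scale0r 1) hml scale0r rpred0.
    have n0 : n != 0.
      rewrite /n /hnorm sqrtC_eq0; apply: contraNneq xi0 => /h0 ->; exact: eqxx.
    have -> : x i = n *: (n^-1 *: x i) by rewrite scalerA divff // scale1r.
    rewrite hml rpredZ // hone // hnormZ //.
    by rewrite normfV ger0_norm ?sqrtC_ge0 // mulVf.
  move=> a ha; apply: IHs => j js; case: (dfwithP x a j) js => // k ik ks.
  by apply: hx; rewrite inE negb_or ks andbT eq_sym.
- by move=> a s t hs ht; rewrite rpredD // rpredZ.
Qed.

(* ut is contained in un by ut_sub_un. *)
Definition ut_dotp (s t : ut_tensor A) : C := tdot (ut_val s) (ut_val t).

End TensorForm.

Section DirectSum.
Context (C : numClosedFieldType) (I : choiceType) (A : I -> unitalHilbertAlgType C).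
Local Notation X := (forall i, A i).
Local Notation T := (tensor A).
Implicit Types x y z u v : X.

Definition class_proj u (t : T) : T :=
  tlift (fun x => if `[< sim x u >] then tmap x else 0) t.

Lemma sim_dfwith x i (a : A i) : sim (dfwith x a) x.
Proof.
apply: (@sub_finite_set _ _ [set i]); last exact: finite_set1.
by move=> j /=; case: (dfwithP x a j) => // k _ [].
Qed.

Lemma class_proj_ml u : multilinear (fun x => if `[< sim x u >] then tmap x else 0).
Proof.
move=> i x c a b.
have e (d : A i) : `[< sim (dfwith x d) u >] = `[< sim x u >].
  apply: asbool_equiv_eq; split; apply: sim_trans; last exact: sim_dfwith.
  by apply: sim_sym; exact: sim_dfwith.
rewrite !e; case: ifP => _; first exact: tmap_multilinear.
by rewrite scaler0 addr0.
Qed.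

Lemma class_proj_class u w t : Omega_ut w -> t \in tensor_class w ->
  w u -> class_proj u t = t.
Proof.
move=> [v hv ->] + [hu uv]; move: t; apply: lspan_ind.
- by have := tlift_linear (class_proj_ml u) (-1) 0 0; rewrite !scaleN1r !addNr.
- move=> t [x [z [[hz zv] xz ->]]]; rewrite /class_proj (tlift_tmap (class_proj_ml u)).
  rewrite asboolT //; apply: sim_trans xz _; apply: sim_trans zv _; exact: sim_sym.
- by move=> a p q hp hq; rewrite /class_proj (tlift_linear (class_proj_ml u)) [tlift _ p]hp [tlift _ q]hq.
Qed.

Lemma class_proj_other u w t : (forall i, unitary (u i)) ->
  Omega_ut w -> t \in tensor_class w -> ~ w u -> class_proj u t = 0.
Proof.
move=> hu [v hv ->] + nu; move: t; apply: lspan_ind.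
- by have := tlift_linear (class_proj_ml u) (-1) 0 0; rewrite !scaleN1r !addNr.
- move=> t [x [z [[hz zv] xz ->]]]; rewrite /class_proj (tlift_tmap (class_proj_ml u)).
  rewrite asboolF // => xu; apply: nu; split=> //.
  apply: sim_trans (sim_sym xu) _; exact: sim_trans xz _.
- move=> a p q hp hq; rewrite /class_proj (tlift_linear (class_proj_ml u)) [tlift _ p]hp [tlift _ q]hq.
  by rewrite scaler0 addr0.
Qed.

Lemma Omega_ut_eq w w' u : Omega_ut w -> Omega_ut w' -> w u -> w' u -> w = w'.
Proof.
have sub v v' : sim u v -> sim u v' -> forall z, sim z v -> sim z v'.
  by move=> uv uv' z zv; apply: sim_trans zv (sim_trans (sim_sym uv) uv').
move=> [v hv ->] [v' hv' ->] [hu uv] [_ uv']; apply/seteqP.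
by split=> z [hz zv]; split=> //; apply: sub zv.
Qed.

Lemma tensor_class_direct (s : seq (set X)) (t : set X -> T) : uniq s ->
  (forall w, w \in s -> Omega_ut w /\ t w \in tensor_class w) ->
  \sum_(w <- s) t w = 0 -> forall w, w \in s -> t w = 0.
Proof.
move=> us hs hsum w ws; have [hw tw] := hs w ws.
have [u hu wE] := hw.
have wu : w u by rewrite wE; split=> //; exact: sim_refl.
pose g : {linear T -> T} := HB.pack (class_proj u)
  (GRing.isLinear.Build _ _ _ _ (class_proj u) (tlift_linear (class_proj_ml u))).
have := congr1 g hsum; rewrite linear0 linear_sum (bigD1_seq w) //= big_seq_cond big1.
  by rewrite addr0 (class_proj_class hw).
move=> w' /andP [w's w'w]; have [hw' tw'] := hs w' w's.
apply: (class_proj_other hu hw' tw') => w'u; move/eqP: w'w; apply.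
exact: (Omega_ut_eq hw' hw w'u wu).
Qed.

End DirectSum.

(* Main.v *)
(* Everything rests on one orthogonality argument. Fix a coordinate i0 and an
   element a of A i0 with ||a b||^2 <= c ||b||^2. The properties <t,t> >= 0,
   <t,t> = 0 -> t = 0 and ||L t||^2 <= c ||t||^2, where L multiplies the i0-th
   coordinate by a, pass to sums of tensors that are orthogonal and have
   orthogonal images under L. Tensors from different unitary classes are
   orthogonal; inside a class, Gram-Schmidt in the finitely many coordinates
   other than i0 splits a tensor orthogonally into elementary tensors that vary
   only in the i0-th coordinate, where the properties hold in A i0.
   An elementary tensor of the class of u is a finite product of such operators L
   and of multiplication by the unitary u, so it acts boundedly on the left. *)
Require Import Defs.
From HB Require Import structures.
From mathcomp Require Import all_boot all_order all_algebra.
From mathcomp Require Import boolp classical_sets functions cardinality fsbigop.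
From mathcomp Require Import reals complex ring.

Set Implicit Arguments.
Unset Strict Implicit.
Unset Printing Implicit Defensive.

Import Order.TTheory GRing.Theory Num.Theory.
Local Open Scope classical_set_scope.
Local Open Scope ring_scope.

(** * Linear spans *)

Section LinearSpanTheory.
Context (K : nzRingType) (V : lmodType K).
Implicit Types S : set V.

Lemma lspan_min S (P : submodClosed V) : (forall v, S v -> v \in P) ->
  forall v, v \in lspan S -> v \in P.
Proof.
move=> SP; apply: lspan_ind => [|//|a u v hu hv]; first exact: rpred0.
by rewrite rpredD // rpredZ.
Qed.

Lemma lspanS S1 S2 : S1 `<=` S2 -> {subset lspan S1 <= lspan S2}.
Proof. by move=> h; apply: lspan_min => v /h; exact: lspan_gen. Qed.

(** Serves to cut a tensor into two summands once the generators have been sorted into two mutually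
    orthogonal families. *)
Lemma lspan_setU S S1 S2 : S `<=` S1 `|` S2 -> forall v, v \in lspan S ->
  exists v1 v2, [/\ v1 \in lspan S1, v2 \in lspan S2 & v = v1 + v2].
Proof.
move=> SU; apply: lspan_ind => [|v /SU [h|h]|a u v [u1 [u2 [h1 h2 ->]]] [v1 [v2 [k1 k2 ->]]]].
- by exists 0, 0; rewrite !rpred0 addr0.
- by exists v, 0; rewrite rpred0 addr0 lspan_gen.
- by exists 0, v; rewrite rpred0 add0r lspan_gen.
- exists (a *: u1 + v1), (a *: u2 + v2); rewrite !rpredD ?rpredZ //.
  by rewrite scalerDr addrACA.
Qed.

End LinearSpanTheory.

(** * A single Hilbert algebra: squared bounds and orthonormal families *)

Section HilbertAlgebra.
Context (C : numClosedFieldType) (A : unitalHilbertAlgType C).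
Implicit Types a b c : A.
Local Notation dot := (@dotp C A).

Lemma dotDl a b c : dot (a + b) c = dot a c + dot b c.
Proof.
have [[h _ _ _] _ _ _ _] := @dotp_hilbert C A.
by have := h c 1 a b; rewrite scale1r mul1r.
Qed.

Lemma dot0l c : dot 0 c = 0.
Proof. by apply: (addrI (dot 0 c)); rewrite -dotDl !addr0. Qed.

Lemma dotZl k a c : dot (k *: a) c = k * dot a c.
Proof.
have [[h _ _ _] _ _ _ _] := @dotp_hilbert C A.
by have := h c k a 0; rewrite !addr0 dot0l addr0.
Qed.

Lemma dotC a b : dot a b = (dot b a)^*.
Proof. by have [[_ h _ _] _ _ _ _] := @dotp_hilbert C A. Qed.

Lemma dot_ge0 a : 0 <= dot a a.
Proof. by have [[_ _ h _] _ _ _ _] := @dotp_hilbert C A. Qed.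

Lemma dot_eq0 a : dot a a = 0 -> a = 0.
Proof. by have [[_ _ _ h] _ _ _ _] := @dotp_hilbert C A; exact: h. Qed.

Lemma dot_mull a b c : dot (a * b) c = dot b (star a * c).
Proof. by have [_ h _ _ _] := @dotp_hilbert C A. Qed.

Lemma dot_star a b : dot a b = dot (star b) (star a).
Proof. by have [_ _ h _ _] := @dotp_hilbert C A. Qed.

Lemma dot_sumZl (s : seq A) (k : A -> C) c :
  dot (\sum_(e <- s) k e *: e) c = \sum_(e <- s) k e * dot e c.
Proof.
elim: s => [|e s IHs]; first by rewrite !big_nil dot0l.
by rewrite !big_cons dotDl dotZl IHs.
Qed.

Lemma hnormE a : hnorm dot a ^+ 2 = dot a a.
Proof. exact: sqrtCK. Qed.

(** Boundedness in squared form, which adds up over orthogonal sums. The sign of [M] comes from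
    testing the bound at [1], a vector of norm 1. *)
Lemma dot_bounded a : hnorm dot 1 = 1 ->
  exists2 M : C, 0 <= M & forall b, dot (a * b) (a * b) <= M * dot b b.
Proof.
move=> h1; have [_ _ _ /(_ a) [M hM] _] := @dotp_hilbert C A.
have M0 : 0 <= M.
  by have := hM 1; rewrite h1 !mulr1; apply: le_trans; rewrite sqrtC_ge0 dot_ge0.
exists (M ^+ 2) => [|b]; first exact: exprn_ge0.
rewrite -!hnormE -exprMn ler_sqr ?nnegrE ?mulr_ge0 ?sqrtC_ge0 ?dot_ge0 //.
Qed.

Definition orthonormal (s : seq A) : bool :=
  pairwise (fun a b => dot a b == 0) s && all (fun a => dot a a == 1) s.

Lemma orthonormal_cons a s : orthonormal (a :: s) =
  [&& all (fun b => dot a b == 0) s, dot a a == 1 & orthonormal s].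
Proof. by rewrite /orthonormal /= -!andbA; do !bool_congr. Qed.

(** The sum is the orthogonal projection of [a] to the span of [s], so what remains of [a] is
    orthogonal to [s]. *)
Lemma dot_proj s a e : orthonormal s -> e \in s ->
  dot (\sum_(f <- s) dot a f *: f) e = dot a e.
Proof.
rewrite dot_sumZl; elim: s => // f s IHs.
rewrite orthonormal_cons => /and3P [/allP fs /eqP f1 os].
rewrite inE big_cons => /orP [/eqP ->|es].
  rewrite f1 mulr1 big_seq big1 ?addr0 // => g gs.
  by rewrite [dot g f]dotC (eqP (fs _ gs)) conjC0 mulr0.
by rewrite (eqP (fs _ es)) mulr0 add0r IHs.
Qed.

Lemma gram_schmidt (s : seq A) : exists2 e : seq A, orthonormal e &
  forall a, a \in s -> a \in lspan [set` e].
Proof.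
elim: s => [|v s [e oe he]]; first by exists [::].
pose p := \sum_(f <- e) dot v f *: f.
have pe : p \in lspan [set` e].
  by rewrite /p big_seq rpred_sum // => f fe; rewrite rpredZ // lspan_gen.
(* If the residual vanishes, [v] already lies in the span of [e]; otherwise the normalized residual
   [w] is added to [e]. *)
have [vp|vp] := eqVneq (v - p) 0.
  exists e => // a; rewrite inE => /orP [/eqP ->|]; last exact: he.
  by move/eqP: vp; rewrite subr_eq0 => /eqP ->.
have w0 : hnorm dot (v - p) != 0.
  by rewrite sqrtC_eq0; apply: contraNneq vp => /dot_eq0 ->.
pose w := (hnorm dot (v - p))^-1 *: (v - p).
have we f : f \in e -> dot w f = 0.
  move=> fe; rewrite dotZl dotDl -scaleN1r dotZl dot_proj // mulN1r subrr.
  by rewrite mulr0.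
have ww : dot w w = 1.
  rewrite dotZl dotC dotZl rmorphM /= -dotC -hnormE.
  rewrite geC0_conj ?invr_ge0 ?sqrtC_ge0 ?dot_ge0 //.
  by rewrite mulrA -expr2 -exprMn mulVf // expr1n.
exists (w :: e).
  rewrite orthonormal_cons ww eqxx oe !andbT; apply/allP => f fe.
  by rewrite we.
have sub : {subset lspan [set` e] <= lspan [set` w :: e]}.
  by apply: lspanS => f /= fe; rewrite inE fe orbT.
move=> a; rewrite inE => /orP [/eqP ->|/he]; last exact: sub.
have -> : v = hnorm dot (v - p) *: w + p.
  by rewrite scalerA divff // scale1r subrK.
by rewrite rpredD ?(sub _ pe) // rpredZ // lspan_gen //= inE eqxx.
Qed.

End HilbertAlgebra.

(** * The form on the tensor product: algebraic identities and orthogonality of pure tensors *)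

Section Form.
Context (C : numClosedFieldType) (I : choiceType) (A : I -> unitalHilbertAlgType C).
Local Notation X := (forall i, A i).
Local Notation T := (tensor A).
Implicit Types (x y z u v : X) (s t r : T).

Lemma tdotDl s t r : tdot (s + t) r = tdot s r + tdot t r.
Proof. by have := tdot_scalar r 1 s t; rewrite scale1r mul1r. Qed.

Lemma tdot0l r : tdot 0 r = 0.
Proof. by apply: (addrI (tdot 0 r)); rewrite -tdotDl !addr0. Qed.

Lemma tdotZl (k : C) s r : tdot (k *: s) r = k * tdot s r.
Proof. by have := tdot_scalar r k s 0; rewrite !addr0 tdot0l addr0. Qed.

Lemma tdotC s t : tdot s t = (tdot t s)^*.
Proof.
elim/tensor_ind: s => [|x|a s1 s2 h1 h2].
- by rewrite tdot0l tdot0r conjC0.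
- elim/tensor_ind: t => [|y|a t1 t2 h1 h2].
  + by rewrite tdot0l tdot0r conjC0.
  + by rewrite !tdot_tmap phi1_conj.
  + by rewrite tdot_conjlinear tdotDl tdotZl h1 h2 rmorphD /= rmorphM /=.
- by rewrite tdot_conjlinear tdotDl tdotZl h1 h2 rmorphD /= rmorphM /= conjCK.
Qed.

Lemma tdotDr s t r : tdot r (s + t) = tdot r s + tdot r t.
Proof. by rewrite tdotC tdotDl rmorphD /= -!tdotC. Qed.

Lemma tdotZr (k : C) s r : tdot r (k *: s) = k^* * tdot r s.
Proof. by rewrite tdotC tdotZl rmorphM /= -tdotC. Qed.

Lemma phi1_eq x y x' y' :
  (forall i, dotp (x i) (y i) = dotp (x' i) (y' i)) -> phi1 x y = phi1 x' y'.
Proof.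
(* [G] shows [phi1] as a function of the family of factors alone, so extensionality settles the
   finiteness test and the product together. *)
pose G (g : I -> C) := if `[< finite_set [set i | g i != 1] >]
  then \big[*%R/1]_(i \in [set: I]) g i else 0.
move=> h; rewrite -[phi1 x y]/(G _) -[phi1 x' y']/(G _); congr G.
exact: functional_extensionality_dep.
Qed.

Lemma tdot_mull s t r : tdot (s * t) r = tdot t (star s * r).
Proof.
elim/tensor_ind: s => [|x|a s1 s2 h1 h2].
- by rewrite mul0r tdot0l [star _]tstar0 mul0r tdot0r.
- elim/tensor_ind: t => [|y|a t1 t2 h1 h2].
  + by rewrite mulr0 !tdot0l.
  + elim/tensor_ind: r => [|z|a r1 r2 h1 h2].
    * by rewrite mulr0 !tdot0r.
    * rewrite starE !tmulE !tdot_tmap; apply: phi1_eq => i; exact: dot_mull.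
    * by rewrite mulrDr -scalerAr !tdotDr !tdotZr h1 h2.
  + by rewrite mulrDr -scalerAr !tdotDl !tdotZl h1 h2.
- by rewrite mulrDl -scalerAl tdotDl tdotZl h1 h2 starD starZ mulrDl -scalerAl
    tdotDr tdotZr conjCK.
Qed.

Lemma tdot_star s t : tdot s t = tdot (star t) (star s).
Proof.
elim/tensor_ind: s => [|x|a s1 s2 h1 h2].
- by rewrite [star 0]tstar0 tdot0l tdot0r.
- elim/tensor_ind: t => [|y|a t1 t2 h1 h2].
  + by rewrite [star 0]tstar0 tdot0l tdot0r.
  + by rewrite !starE !tdot_tmap; apply: phi1_eq => i; exact: dot_star.
  + by rewrite tdotDr tdotZr h1 h2 starD starZ tdotDl tdotZl.
- by rewrite tdotDl tdotZl h1 h2 starD starZ tdotDr tdotZr conjCK.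
Qed.

(** The map [L] lets one statement cover the tensors themselves ([idfun]) and their images under
    [cmul]. *)
Lemma tdot_lspan0 (L : {linear T -> T}) (S1 S2 : set T) :
  (forall s t, S1 s -> S2 t -> tdot (L s) (L t) = 0) ->
  forall s t, s \in lspan S1 -> t \in lspan S2 -> tdot (L s) (L t) = 0.
Proof.
move=> h s t hs ht; move: s hs; apply: lspan_ind => [|s hs|a s1 s2 h1 h2].
- by rewrite linear0 tdot0l.
- move: t ht; apply: lspan_ind => [|t ht|a t1 t2 h1 h2].
  + by rewrite linear0 tdot0r.
  + exact: h.
  + by rewrite linearP tdotDr tdotZr h1 h2 mulr0 addr0.
- by rewrite linearP tdotDl tdotZl h1 h2 mulr0 addr0.
Qed.

(** A zero factor differs from 1, hence occurs in the finite product when there is one; otherwise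
    [phi1] is 0 by default. *)
Lemma phi1_orthogonal x y i : dotp (x i) (y i) = 0 -> phi1 x y = 0.
Proof.
move=> h; rewrite /phi1; case: asboolP => // fin.
rewrite -(fsbig_widen [set j | dotp (x j) (y j) != 1]) //; last first.
  by move=> j [_ /= /negP]; rewrite negbK => /eqP.
rewrite (fsbigD1 i) //=; last by rewrite h eq_sym oner_eq0.
by rewrite h mul0r.
Qed.

(** Equality case of Cauchy-Schwarz: the squared norm of [a - b] is 1 - 1 - 1 + 1. *)
Lemma unit_dot_eq i (a b : A i) :
  dotp a a = 1 -> dotp b b = 1 -> dotp a b = 1 -> a = b.
Proof.
move=> aa bb ab; apply/eqP; rewrite -subr_eq0; apply/eqP/dot_eq0.
have dr (c p q : A i) : dotp c (p + q) = dotp c p + dotp c q.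
  by rewrite dotC dotDl rmorphD /= -!dotC.
have dn (c p : A i) : dotp c (- p) = - dotp c p.
  by rewrite dotC -scaleN1r dotZl mulN1r rmorphN /= -dotC.
have ba : dotp b a = 1 by rewrite dotC ab conjC1.
by rewrite dotDl -scaleN1r dotZl scaleN1r !dr !dn aa ab ba bb !subrr mulr0 addr0.
Qed.

(** Outside a finite set the factors are [dotp (u i) (v i)], and by [unit_dot_eq] such a factor is 1
    only if [u i = v i]. So infinitely many factors differ from 1, and [phi1] takes its default
    value. *)
Lemma phi1_not_sim x y u v : (forall i, dotp (u i) (u i) = 1) ->
  (forall i, dotp (v i) (v i) = 1) -> sim x u -> sim y v -> ~ sim x y ->
  phi1 x y = 0.
Proof.
move=> u1 v1 xu yv nxy; rewrite /phi1 asboolF // => fin; apply: nxy.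
apply: (sim_trans xu); apply: sim_trans (sim_sym yv).
pose D := [set i | x i <> u i] `|` [set i | y i <> v i].
apply: (@sub_finite_set _ _ (D `|` [set i | dotp (x i) (y i) != 1])); last first.
  by rewrite !finite_setU.
move=> i /= uv; case: (pselect (x i = u i)) => [xi|xi]; last by left; left.
case: (pselect (y i = v i)) => [yi|yi]; last by left; right.
by right; rewrite xi yi; apply/eqP => h; apply: uv; exact: unit_dot_eq.
Qed.

Lemma phi1_dfwith z (i : I) (a b : A i) : (forall j, dotp (z j) (z j) = 1) ->
  phi1 (dfwith z a) (dfwith z b) = dotp a b.
Proof.
move=> z1; have e j : j <> i -> dotp (dfwith z a j) (dfwith z b j) = 1.
  by move=> /eqP ji; rewrite !dfwith_out // eq_sym.
rewrite /phi1 asboolT; last first.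
  apply: (@sub_finite_set _ _ [set i]); last exact: finite_set1.
  by move=> j /= /eqP h; apply: contrapT => ji; apply: h; exact: e.
rewrite -(fsbig_widen [set i]) ?fsbig_set1 ?dfwith_in // => j [_ /= ji].
exact: e.
Qed.

Lemma tmap_dfwithP x (i : I) (k : C) (a b : A i) :
  tmap (dfwith x (k *: a + b)) = k *: tmap (dfwith x a) + tmap (dfwith x b).
Proof. exact: tmap_multilinear. Qed.

Lemma tmap_dfwith0 x (i : I) : tmap (dfwith x (0 : A i)) = 0.
Proof. by have := tmap_dfwithP x (-1) (0 : A i) 0; rewrite !scaleN1r !addNr. Qed.

Lemma dfwith_eq x (i : I) (a : A i) : x i = a -> dfwith x a = x.
Proof.
by move=> <-; apply: functional_extensionality_dep => j; case: dfwithP.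
Qed.

Lemma dot_unitary u : (forall i, hnorm (@dotp C (A i)) 1 = 1) ->
  (forall i, unitary (u i)) -> forall i, dotp (u i) (u i) = 1.
Proof. by move=> he hu i; rewrite -hnormE hnorm_unitary // expr1n. Qed.

(** * Positivity, definiteness and one-coordinate bounds by orthogonal splitting *)

Section Coordinate.
Context (i0 : I) (a : A i0) (c : C).
Context (ac : forall b : A i0, dotp (a * b) (a * b) <= c * dotp b b).

Definition cmul t : T := tmap (dfwith (fun=> 1) a) * t.

Lemma cmul_linear : linear cmul.
Proof. by move=> k s t; rewrite /cmul mulrDr scalerAr. Qed.
HB.instance Definition _ := GRing.isLinear.Build C T T _ cmul cmul_linear.

Lemma cmul_tmap x : cmul (tmap x) = tmap (dfwith x (a * x i0)).
Proof.
rewrite /cmul tmulE; congr tmap; apply: functional_extensionality_dep => i.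
by case: (dfwithP x (a * x i0) i) => [|j ij]; rewrite ?dfwith_in ?dfwith_out ?mul1r.
Qed.

Definition good t : Prop :=
  [/\ 0 <= tdot t t, tdot t t = 0 -> t = 0 &
      tdot (cmul t) (cmul t) <= c * tdot t t].

(** Pythagoras for [s + t] and for its image; a vanishing sum of nonnegative squared norms has
    vanishing terms. *)
Lemma good_add s t : tdot s t = 0 -> tdot (cmul s) (cmul t) = 0 ->
  good s -> good t -> good (s + t).
Proof.
move=> st cst [s0 sE sc] [t0 tE tc].
have E (p q : T) : tdot p q = 0 -> tdot (p + q) (p + q) = tdot p p + tdot q q.
  move=> pq; rewrite tdotDl !tdotDr pq addr0 [tdot q p]tdotC pq conjC0.
  by rewrite add0r.
rewrite /good linearD !E //; split.
- exact: addr_ge0.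
- move/eqP; rewrite paddr_eq0 // => /andP [/eqP /sE -> /eqP /tE ->].
  by rewrite addr0.
- by rewrite mulrDr lerD.
Qed.

Lemma good_lspanU (S S1 S2 : set T) : S `<=` S1 `|` S2 ->
  (forall s t, S1 s -> S2 t -> tdot s t = 0) ->
  (forall s t, S1 s -> S2 t -> tdot (cmul s) (cmul t) = 0) ->
  (forall t, t \in lspan S1 -> good t) -> (forall t, t \in lspan S2 -> good t) ->
  forall t, t \in lspan S -> good t.
Proof.
move=> SU o1 o2 g1 g2 t /(lspan_setU SU) [t1 [t2 [h1 h2 ->]]].
apply: good_add; [|exact: (tdot_lspan0 o2)|exact: g1|exact: g2].
exact: (@tdot_lspan0 idfun S1 S2).
Qed.

Lemma good0 : good 0.
Proof. by rewrite /good linear0 !tdot0l mulr0 lexx. Qed.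

Definition tmaps (P : set X) : set T := [set tmap x | x in P].

(** Coordinate [i0] is always free; [F] lists the further free coordinates, on which the induction
    runs. *)
Definition agree_off (F : seq I) z : set X :=
  [set x | forall i, i != i0 -> i \notin F -> x i = z i].

(** With only [i0] free, every tensor of the span is a single [tmap (dfwith z b)], and [b] in [A i0]
    determines its norm isometrically. *)
Lemma good_base z t : (forall i, dotp (z i) (z i) = 1) ->
  t \in lspan (tmaps (agree_off [::] z)) -> good t.
Proof.
move=> z1 ht.
have [b ->] : exists b, t = tmap (dfwith z (b : A i0)).
  move: t ht; apply: lspan_ind => [|_ [x hx <-]|k s t [b ->] [d ->]].
  - by exists 0; rewrite tmap_dfwith0.
  - exists (x i0); congr tmap; apply: functional_extensionality_dep => j.
    by case: dfwithP => // j' ij; rewrite hx // eq_sym.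
  - by exists (k *: b + d); rewrite tmap_dfwithP.
rewrite /good cmul_tmap dfwith_in.
have -> : dfwith (dfwith z b) (a * b) = dfwith z (a * b).
  apply: functional_extensionality_dep => j.
  by case: (dfwithP z (a * b) j) => [|j' ij]; rewrite ?dfwith_in ?dfwith_out.
rewrite !tdot_tmap !phi1_dfwith //; split; first exact: dot_ge0.
  by move/dot_eq0 ->; rewrite tmap_dfwith0.
exact: ac.
Qed.

(** Tensors with distinct entries of [e] at [i] are orthogonal, and remain so under [cmul] because
    [i] is not [i0]. Each piece has its coordinate [i] frozen at a unit vector, which leaves only
    [F] free. *)
Lemma good_orthonormal F z (i : I) (e : seq (A i)) : i != i0 ->
  (forall z', (forall j, dotp (z' j) (z' j) = 1) ->
     forall t, t \in lspan (tmaps (agree_off F z')) -> good t) ->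
  (forall j, dotp (z j) (z j) = 1) -> orthonormal e ->
  forall t, t \in lspan (tmaps (agree_off (i :: F) z `&` [set x | x i \in e])) ->
  good t.
Proof.
move=> ii0 gF z1; elim: e => [|f e IHe].
  move=> _ t /lspanP [[|p s] [h ->]]; first by rewrite big_nil; exact: good0.
  by have [x []] := h p (mem_head _ _).
rewrite orthonormal_cons => /and3P [/allP fe /eqP f1 oe].
set S1 := tmaps (agree_off (i :: F) z `&` [set x | x i = f]).
set S2 := tmaps (agree_off (i :: F) z `&` [set x | x i \in e]).
apply: (@good_lspanU _ S1 S2).
- move=> _ [x [hx /= xfe] <-]; move: xfe; rewrite inE => /orP [/eqP xf|xe].
    by left; exists x.
  by right; exists x.
- move=> _ _ [x [_ xf] <-] [y [_ ye] <-]; rewrite tdot_tmap.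
  by apply: (@phi1_orthogonal _ _ i); rewrite xf; apply/eqP/fe.
- move=> _ _ [x [_ xf] <-] [y [_ ye] <-]; rewrite !cmul_tmap tdot_tmap.
  apply: (@phi1_orthogonal _ _ i); rewrite !dfwith_out 1?eq_sym // xf.
  exact/eqP/fe.
- have z'1 j : dotp (dfwith z f j) (dfwith z f j) = 1.
    by case: (dfwithP z f j).
  move=> t ht; apply: (gF _ z'1); move: t ht; apply: lspanS => _ [x [hx xf] <-].
  exists x => // j ji0 jF; case: (dfwithP z f j) ji0 jF => // k ik ki0 kF.
  by apply: hx; rewrite // inE negb_or kF andbT eq_sym.
- exact: IHe.
Qed.

(** Induction on [F]: the finitely many vectors that occur at coordinate [i] are replaced by an
    orthonormal family spanning them. *)
Lemma good_agree_off F z t : (forall i, dotp (z i) (z i) = 1) ->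
  t \in lspan (tmaps (agree_off F z)) -> good t.
Proof.
elim: F z t => [|i F IHF] z t z1 ht; first exact: good_base ht.
have [eii0|ii0] := eqVneq i i0.
  apply: (IHF z) => //; move: t ht; apply: lspanS => _ [x hx <-].
  exists x => // j ji0 jF; apply: hx => //.
  by rewrite inE negb_or jF eii0 ji0.
pose S (P : pred (A i)) :=
  tmaps (agree_off (i :: F) z `&` [set x | x i \in P]).
have SS (P Q : pred (A i)) : {subset P <= Q} -> {subset lspan (S P) <= lspan (S Q)}.
  by move=> PQ; apply: lspanS => _ [x [hx xP] <-]; exists x => //; split=> //; exact: PQ.
have [s hs] : exists s : seq (A i), t \in lspan (S (mem s)).
  move: t ht; apply: lspan_ind => [|_ [x hx <-]|k p q [sp hp] [sq hq]].
  - by exists [::]; rewrite rpred0.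
  - by exists [:: x i]; apply: lspan_gen; exists x => //; split=> //=; rewrite inE.
  - exists (sp ++ sq); rewrite rpredD ?rpredZ //.
      by apply: SS hp => b bs; rewrite inE /= mem_cat [_ \in sp]bs.
    by apply: SS hq => b bs; rewrite inE /= mem_cat [_ \in sq]bs orbT.
have [e oe he] := gram_schmidt s.
apply: (@good_orthonormal F z i e) => // [z' z'1 t'|]; first exact: IHF.
move: t hs {ht}; apply: lspan_min => _ [x [hx /he xe] <-].
(* With coordinate [i] exposed, multilinearity expands it in [e]. *)
rewrite -(dfwith_eq (erefl (x i))).
move: (x i) xe; apply: lspan_ind => [|f fe|k p q hp hq].
- by rewrite tmap_dfwith0 rpred0.
- apply: lspan_gen; exists (dfwith x f) => //; split=> /=; last by rewrite dfwith_in.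
  move=> j ji0; rewrite inE negb_or => /andP [ji jF].
  by rewrite dfwith_out 1?eq_sym // hx // inE negb_or ji.
- by rewrite tmap_dfwithP rpredD // rpredZ.
Qed.

(** A linear combination involves finitely many pure tensors, each differing from [u] at finitely
    many coordinates; [F] collects all of these. *)
Lemma good_sim u t : (forall i, dotp (u i) (u i) = 1) ->
  t \in lspan (tmaps [set x | sim x u]) -> good t.
Proof.
move=> u1 ht; suff [F hF] : exists F, t \in lspan (tmaps (agree_off F u)).
  exact: good_agree_off hF.
have mono F G : {subset F <= G} -> {subset lspan (tmaps (agree_off F u))
    <= lspan (tmaps (agree_off G u))}.
  move=> FG; apply: lspanS => _ [x hx <-]; exists x => // i ii0 iG.
  by apply: hx => //; apply: contra iG; exact: FG.
move: t ht; apply: lspan_ind => [|_ [x xu <-]|k p q [F hp] [G hq]].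
- by exists [::]; rewrite rpred0.
- have /finite_seqP [F hF] := xu; exists F; apply: lspan_gen; exists x => // i _ iF.
  apply: contrapT => h; move/negP: iF; apply.
  by have : [set i | x i <> u i] i by []; rewrite hF.
- exists (F ++ G); rewrite rpredD ?rpredZ //.
    by apply: mono hp => i iF; rewrite mem_cat iF.
  by apply: mono hq => i iG; rewrite mem_cat iG orbT.
Qed.

Lemma good_ut t : (forall i, hnorm (@dotp C (A i)) 1 = 1) -> t \in ut (A := A) -> good t.
Proof.
move=> he; rewrite utE => ht.
pose S (us : seq X) := tmaps [set x | exists u,
  [/\ u \in us, forall i, dotp (u i) (u i) = 1 & sim x u]].
have [us {}ht] : exists us, t \in lspan (S us).
  move: t ht; apply: lspan_ind => [|_ [x [u [hu xu ->]]]|k p q [us hp] [vs hq]].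
  - by exists [::]; rewrite rpred0.
  - exists [:: u]; apply: lspan_gen; exists x => //; exists u.
    by split; [rewrite inE|exact: dot_unitary|].
  - exists (us ++ vs); rewrite rpredD ?rpredZ //.
      apply: lspanS hp => _ [x [u [uus u1 xu]] <-]; exists x => //.
      by exists u; rewrite mem_cat uus.
    apply: lspanS hq => _ [x [u [uus u1 xu]] <-]; exists x => //.
    by exists u; rewrite mem_cat uus orbT.
elim: us t ht => [|u us IHus] t.
  move/lspanP => [[|p s] [h ->]]; first by rewrite big_nil; exact: good0.
  by have [x [u []]] := h p (mem_head _ _).
(* A family [u] that is not made of unit vectors contributes nothing to [S]. *)
have [u1|u1] := pselect (forall i, dotp (u i) (u i) = 1); last first.
  move=> ht; apply: IHus; apply: lspanS ht => _ [x [v [+ v1 xv]] <-].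
  rewrite inE => /orP [/eqP vu|vus]; first by case: u1; rewrite -vu.
  by exists x => //; exists v.
(* The class of [u] is removed from [S2], since later entries of [us] may be equivalent to [u]. As
   [cmul] alters one coordinate only, it preserves classes, and the images are orthogonal too. *)
set S1 := tmaps [set x | sim x u].
set S2 := tmaps [set x | ~ sim x u /\
  exists v, [/\ v \in us, forall i, dotp (v i) (v i) = 1 & sim x v]].
apply: (@good_lspanU _ S1 S2).
- move=> _ [x [v [+ v1 xv]] <-]; rewrite inE => /orP [/eqP vu|vus].
    by left; exists x => //; rewrite -vu.
  have [xu|xu] := pselect (sim x u); first by left; exists x.
  by right; exists x => //; split=> //; exists v.
- move=> _ _ [x xu <-] [y [nyu [v [_ v1 yv]]] <-]; rewrite tdot_tmap.
  apply: (phi1_not_sim u1 v1) => // xy; apply: nyu.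
  exact: sim_trans (sim_sym xy) xu.
- move=> _ _ [x xu <-] [y [nyu [v [_ v1 yv]]] <-]; rewrite !cmul_tmap tdot_tmap.
  have dx := sim_dfwith x (a * x i0); have dy := sim_dfwith y (a * y i0).
  apply: (phi1_not_sim u1 v1).
  + exact: sim_trans dx xu.
  + exact: sim_trans dy yv.
  + move=> xy; apply: nyu.
    exact: sim_trans (sim_sym dy) (sim_trans (sim_sym xy) (sim_trans dx xu)).
- by move=> s; exact: good_sim.
- move=> s hs; apply: IHus; apply: lspanS hs => _ [x [_ h] <-]; by exists x.
Qed.

End Coordinate.

(** * Boundedness of left multiplication on [ut] *)

Section Bounded.
Context (he : forall i, hnorm (@dotp C (A i)) 1 = 1) (I0 : exists i : I, True).

Lemma ut_dot_ge0 t : t \in ut (A := A) -> 0 <= tdot t t.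
Proof.
(* Any coordinate will do, with [a = 1] and [c = 1]. *)
case: I0 => i _ ht; have c1 (b : A i) : dotp (1 * b) (1 * b) <= 1 * dotp b b.
  by rewrite !mul1r.
by have [] := good_ut c1 he ht.
Qed.

Lemma ut_dot_eq0 t : t \in ut (A := A) -> tdot t t = 0 -> t = 0.
Proof.
case: I0 => i _ ht; have c1 (b : A i) : dotp (1 * b) (1 * b) <= 1 * dotp b b.
  by rewrite !mul1r.
by have [] := good_ut c1 he ht.
Qed.

Definition lbounded s : Prop := exists2 M : C, 0 <= M &
  forall t, t \in ut (A := A) -> tdot (s * t) (s * t) <= M * tdot t t.

Lemma lbounded_coord (i : I) (a : A i) : lbounded (tmap (dfwith (fun=> 1) a)).
Proof.
have [M M0 hM] := dot_bounded a (he i); exists M => // t ht.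
by have [] := good_ut hM he ht.
Qed.

(** Multiplication by a unitary is isometric, as its adjoint is its inverse. *)
Lemma lbounded_unitary u : (forall i, unitary (u i)) -> lbounded (tmap u).
Proof.
move=> hu; exists 1 => // t _; rewrite mul1r tdot_mull mulrA starE tmulE.
have -> : (fun i => star (u i) * u i) = (fun=> 1).
  by apply: functional_extensionality_dep => i; case: (hu i).
by rewrite mul1r.
Qed.

Lemma lboundedM s t : t \in ut (A := A) -> lbounded s -> lbounded t -> lbounded (s * t).
Proof.
move=> ht [M M0 hM] [N N0 hN]; exists (M * N) => [|r hr]; first exact: mulr_ge0.
rewrite -!mulrA; apply: le_trans (hM _ (ut_mul ht hr)) _.
by rewrite ler_wpM2l // hN.
Qed.

Lemma lbounded_sim x u : (forall i, unitary (u i)) -> sim x u -> lbounded (tmap x).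
Proof.
move=> hu xu; have /finite_seqP [F hF] := xu.
have {hF} : forall i, i \notin F -> x i = u i.
  move=> i iF; apply: contrapT => h; move/negP: iF; apply.
  by have : [set i | x i <> u i] i by []; rewrite hF.
elim: F x xu => [|i F IHF] x xu hx.
  have -> : x = u by apply: functional_extensionality_dep => i; exact: hx.
  exact: lbounded_unitary.
have hy : sim (dfwith x (u i)) u by apply: sim_trans (sim_dfwith _ _) xu.
(* The second factor has [u i] at [i], so it differs from [u] at most on [F]; the first restores
   [x i], since [star (u i) * u i = 1]. *)
have -> : tmap x = tmap (dfwith (fun=> 1) (x i * star (u i))) * tmap (dfwith x (u i)).
  rewrite tmulE; congr tmap; apply: functional_extensionality_dep => j.
  case: (dfwithP x (u i) j) => [|k ik]; last by rewrite dfwith_out // mul1r.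
  by rewrite dfwith_in -mulrA; case: (hu i) => -> _; rewrite mulr1.
apply: lboundedM; [exact: ut_tmap hy|exact: lbounded_coord|apply: IHF => // j jF].
case: (dfwithP x (u i) j) jF => // k ik kF.
by apply: hx; rewrite inE negb_or kF andbT eq_sym.
Qed.

(** The two sides differ by the squared norm of [s - t], which is nonnegative on [ut]. *)
Lemma parallelogram s t : s \in ut (A := A) -> t \in ut (A := A) ->
  tdot (s + t) (s + t) <= 2 * (tdot s s + tdot t t).
Proof.
move=> hs ht; have h := ut_dot_ge0 (rpredB hs ht).
have dn (p q : T) : tdot p (- q) = - tdot p q.
  by rewrite -scaleN1r tdotZr rmorphN1 mulN1r.
have nd (p q : T) : tdot (- q) p = - tdot q p by rewrite -scaleN1r tdotZl mulN1r.
rewrite -subr_ge0; suff -> : 2 * (tdot s s + tdot t t) - tdot (s + t) (s + t) =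
  tdot (s - t) (s - t) by [].
by rewrite !tdotDl !tdotDr !dn !nd; ring.
Qed.

Lemma lbounded_ut s : s \in ut (A := A) -> lbounded s.
Proof.
rewrite utE => hs; suff [] : s \in ut (A := A) /\ lbounded s by [].
move: s hs; apply: lspan_ind.
- split; first exact: rpred0.
  by exists 0 => // t _; rewrite !mul0r tdot0l.
- move=> s [x [u [hu xu ->]]]; split; first exact: ut_tmap xu.
  exact: lbounded_sim xu.
- move=> k s t [hs [M M0 hM]] [ht [N N0 hN]]; split; first by rewrite rpredD // rpredZ.
  (* The factor 2 comes from [parallelogram] applied to [k *: (s * r)] and [t * r]. *)
  exists (2 * (`|k| ^+ 2 * M + N)) => [|r hr].
    by rewrite mulr_ge0 // addr_ge0 // mulr_ge0 // exprn_ge0.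
  rewrite mulrDl -scalerAl; apply: le_trans (parallelogram _ _) _.
  + by rewrite rpredZ // ut_mul.
  + exact: ut_mul.
  rewrite -mulrA ler_pM2l // mulrDl lerD ?hN //.
  by rewrite tdotZl tdotZr mulrA -normCK -[leRHS]mulrA ler_wpM2l ?exprn_ge0 // hM.
Qed.

End Bounded.
End Form.

(** * Verification of the Hilbert algebra axioms *)

Theorem corollary5p10 (R : realType) (I : choiceType)
    (A : I -> unitalHilbertAlgType R[i])
    (hI : infinite_set [set: I])
    (he : forall i : I, hnorm (@dotp R[i] (A i)) 1 = 1) :
  hilbert_algebra (@ut_dotp R[i] I A) /\
  hnorm (@ut_dotp R[i] I A) (ut_pure (fun i : I => @unitary1 R[i] (A i))) = 1.
Proof.
have I0 : exists i : I, True.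
  by have [i _] := infinite_setN0 hI; exists i.
have one1 : tdot (ut_val (1 : ut_tensor A)) (ut_val (1 : ut_tensor A)) = 1.
  rewrite tdot_tmap; apply: (finprod1 (f := fun i a => dotp a 1)) => i.
  by rewrite -hnormE he expr1n.
split; last by rewrite /hnorm /ut_dotp -ut_oneE one1 sqrtC1.
split.
- split=> [t a r s|s t|s|s].
  + exact: tdot_scalar.
  + exact: tdotC.
  + exact: (ut_dot_ge0 he I0 (ut_valP s)).
  + by move=> /(ut_dot_eq0 he I0 (ut_valP s)) s0; exact: val_inj.
- by move=> s t r; exact: tdot_mull.
- by move=> s t; exact: tdot_star.
- move=> s; have [M M0 hM] := lbounded_ut he I0 (ut_valP s).
  (* [M] bounds squared norms, hence the root. *)
  exists (sqrtC M) => t.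
  have t0 := ut_dot_ge0 he I0 (ut_valP t).
  rewrite /hnorm -rootCMl // ler_sqrtC ?qualifE /=; first exact: hM (ut_valP t).
  + exact: (ut_dot_ge0 he I0 (ut_valP (s * t))).
  + exact: mulr_ge0.
(* Density: [s] is itself the product [s * 1]. *)
- move=> s e e0; exists s; last first.
    by rewrite subrr /hnorm /ut_dotp tdot0l sqrtC0.
  by apply: lspan_gen; exists s, 1; rewrite mulr1.
Qed.
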